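(* The Fourier transform operator $\mathfrak{F}$, defined on $\bigcup_{n\ge1}L^1[\mathbb{R}_I^n](h)$ by $$\mathfrak{F}(f_n)(\mathbf{x})=\big(\mathfrak{F}_{(n)}f_{(n)}\big)(x_1,\dots,x_n)\prod_{k=n+1}^\infty\hat h_k(x_k),\qquad f_n=f_{(n)}\otimes\bigotimes_{k\ge n+1}\chi_I,\ f_{(n)}\in L^1(\mathbb{R}^n),$$ extends to a bounded linear mapping of $L^1[\mathbb{R}_I^\infty](h)$ into $\mathbb{C}_0[\mathbb{R}_I^\infty](\hat h)$.
   Context: Let $I=[-\frac12,\frac12]$, $I_n=\prod_{i\ge n+1}I$, $\mathbb{R}_I^n=\mathbb{R}^n\times I_n\subset\mathbb{R}^\infty$. Let $\chi_I$ be the indicator function of $I$, $h=\bigotimes_{k=1}^\infty h_k$ with $h_k=\chi_I$, and $\hat h=\bigotimes_{k=1}^\infty\hat h_k$ with $\hat h_k(x)=\frac{\sin(\pi x)}{\pi x}$. $\mathfrak{F}_{(n)}$ is the $n$-dimensional Fourier transform $(\mathfrak{F}_{(n)}g)(x)=\int_{\mathbb{R}^n}e^{-2\pi i\,x\cdot y}g(y)\,dy$. $L^1[\mathbb{R}_I^n](h)$ is the space of functions $f_n=f_{(n)}\otimes\bigotimes_{k\ge n+1}\chi_I$ with $f_{(n)}\in L^1(\mathbb{R}^n)$, normed by $\|f_n\|_1=\|f_{(n)}\|_{L^1(\mathbb{R}^n)}$ (its integral with respect to the measure $\lambda_\infty$ given by $\lambda_\infty(A\times I_n)=\lambda_n(A)$).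 These spaces increase with $n$, and $L^1[\mathbb{R}_I^\infty](h)$ is the $L^1$-norm closure (completion) of their union. $\mathbb{C}_0[\mathbb{R}_I^n](\hat h)$ is the space of functions $g\otimes\bigotimes_{k\ge n+1}\hat h_k$ with $g\in C_0(\mathbb{R}^n)$ (continuous, vanishing at infinity), and $\mathbb{C}_0[\mathbb{R}_I^\infty](\hat h)$ is the closure of the union of these spaces in the sup norm. *)

(* Defs.v *)
From HB Require Import structures.
From mathcomp Require Import all_boot all_order all_algebra.
From mathcomp Require Import complex.
From mathcomp Require Import all_classical all_reals all_analysis.

Set Implicit Arguments.
Unset Strict Implicit.
Unset Printing Implicit Defensive.

Import Order.TTheory GRing.Theory Num.Theory.
Import numFieldNormedType.Exports.

Local Open Scope classical_set_scope.
Local Open Scope ring_scope.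
Local Open Scope complex_scope.

(* [measurableTypeR R] is R with its Borel sigma-algebra, the type on which
   [lebesgue_measure] lives; R^n is [Rn R n], R^oo is [nat -> R] and
   the scalar field is [R[i]].  Indices start at 0: the coordinate x_k (k >= 1)
   of the literature is [x k.-1], so that a product over k >= n + 1 becomes a
   product over k >= n. *)

Notation Rn R n := (n.-tuple (measurableTypeR R)).

Section lebesgue_measure_on_tuples.
Context {R : realType}.
Local Notation T := (measurableTypeR R).

Definition consT n (p : T * n.-tuple T) : n.+1.-tuple T :=
  [the n.+1.-tuple T of p.1 :: p.2].

Definition unconsT n (t : n.+1.-tuple T) : T * n.-tuple T :=
  (thead t, [tuple of behead t]).

Lemma measurable_consT n : measurable_fun setT (@consT n).
Proof. exact: (measurable_cons measurable_fst measurable_snd). Qed.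

Lemma measurable_unconsT n : measurable_fun setT (@unconsT n).
Proof.
apply: measurable_fun_pair; last exact: measurable_behead.
exact: measurable_tnth.
Qed.

Lemma consTK n : cancel (@consT n) (@unconsT n).
Proof.
by case=> x t; rewrite /unconsT /consT theadE; congr (_, _); exact: val_inj.
Qed.

Section succ.
Variables (n : nat) (m : {sigma_finite_measure set (n.-tuple T) -> \bar R}).

Definition lebesgue_succ : set (n.+1.-tuple T) -> \bar R :=
  pushforward (@lebesgue_measure R \x m)%E (@consT n).

Let lebesgue_succ0 : lebesgue_succ set0 = 0%E.
Proof. by rewrite /lebesgue_succ /pushforward preimage_set0 measure0. Qed.

Let lebesgue_succ_ge0 A : (0 <= lebesgue_succ A)%E.
Proof. by rewrite /lebesgue_succ /pushforward measure_ge0. Qed.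

Let lebesgue_succ_sigma_additive : semi_sigma_additive lebesgue_succ.
Proof.
move=> F mF tF mUF; rewrite /lebesgue_succ /pushforward preimage_bigcup.
apply: measure_semi_sigma_additive.
- by move=> k; rewrite -[X in measurable X]setTI; exact: measurable_consT.
- apply/trivIsetP => /= k l _ _ kl; rewrite -preimage_setI.
  by move/trivIsetP : tF => /(_ _ _ _ _ kl) ->//; rewrite preimage_set0.
- by rewrite -preimage_bigcup -[X in measurable X]setTI; exact: measurable_consT.
Qed.

HB.instance Definition _ := isMeasure.Build _ _ _ lebesgue_succ
  lebesgue_succ0 lebesgue_succ_ge0 lebesgue_succ_sigma_additive.

Let lebesgue_succ_sigma_finite : sigma_finite setT lebesgue_succ.
Proof.
have /sigma_finiteP[F [FT ndF Foo]] := sigma_finiteT (@lebesgue_measure R).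
have /sigma_finiteP[G [GT ndG Goo]] := sigma_finiteT m.
pose H k := F k `*` G k.
exists (fun k => @unconsT n @^-1` H k).
  rewrite -preimage_bigcup (_ : \bigcup_k H k = setT) ?preimage_setT//.
  apply/seteqP; split=> // -[x t] _.
  have : setT x by []. have : setT t by [].
  rewrite {1}GT {1}FT => -[l _ Glt] [k _ Fkx].
  exists (maxn k l) => //; split=> /=.
    by move: Fkx; exact/subsetPset/ndF/leq_maxl.
  by move: Glt; exact/subsetPset/ndG/leq_maxr.
move=> k; have [mF Ffin] := Foo k; have [mG Gfin] := Goo k; split.
  rewrite -[X in measurable X]setTI; apply: measurable_unconsT => //.
  exact: measurableX.
rewrite /lebesgue_succ /pushforward.
rewrite (_ : @consT n @^-1` (@unconsT n @^-1` H k) = H k); last first.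
  by apply/seteqP; split=> x /=; rewrite consTK.
by rewrite product_measure1E// lte_mul_pinfty// ge0_fin_numE.
Qed.

HB.instance Definition _ := Measure_isSigmaFinite.Build _ _ _ lebesgue_succ
  lebesgue_succ_sigma_finite.

End succ.

Fixpoint lebesgue_tuple n : {sigma_finite_measure set (n.-tuple T) -> \bar R} :=
  if n is n'.+1 then lebesgue_succ (lebesgue_tuple n') else \d_[tuple].

End lebesgue_measure_on_tuples.

Section spaces.
Context {R : realType}.

Definition cintegral n (f : Rn R n -> R[i]) : R[i] :=
  (\int[lebesgue_tuple n]_y complex.Re (f y)) +i*
  (\int[lebesgue_tuple n]_y complex.Im (f y)).

Definition L1 n (f : Rn R n -> R[i]) : Prop :=
  (lebesgue_tuple n).-integrable setT (fun y => (complex.Re (f y))%:E) /\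
  (lebesgue_tuple n).-integrable setT (fun y => (complex.Im (f y))%:E).

Definition L1norm n (f : Rn R n -> R[i]) : R :=
  \int[lebesgue_tuple n]_y Normc.normc (f y).

(* exp (i t) *)
Definition expi (t : R) : R[i] := cos t +i* sin t.

Definition fourier n (f : Rn R n -> R[i]) (x : Rn R n) : R[i] :=
  cintegral (fun y =>
    expi (- (2 * pi * \sum_(i < n) tnth x i * tnth y i)) * f y).

Definition tuple_of_row n (v : 'rV[R]_n) : Rn R n :=
  [tuple v ord0 i | i < n].

(* The topology of R^n is that of row vectors. *)
Definition C0 n (g : Rn R n -> R[i]) : Prop :=
  continuous (fun v : 'rV[R]_n => g (tuple_of_row v) : R[i]^o) /\
  forall e : R, 0 < e -> exists K : set 'rV[R]_n, compact K /\
    forall v, ~ K v -> Normc.normc (g (tuple_of_row v)) < e.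

(* The indicator function of I = [-1/2, 1/2]. *)
Definition chiI (x : R) : R := \1_`[- 2^-1, 2^-1]%classic x.

Definition hhat (x : R) : R := if x == 0 then 1 else sin (pi * x) / (pi * x).

(* The tensor product of f (first n coordinates) and of copies of u (all the
   others), at the point x; the infinite product is the limit of the partial
   products. *)
Definition tensor (u : R -> R) n (f : Rn R n -> R[i]) (x : nat -> R) : R[i] :=
  f [tuple x i | i < n] * (limn (fun N => \prod_(n <= k < N) u (x k)))%:C.

Definition L1_union : set ((nat -> R) -> R[i]) :=
  [set F | exists n (f : Rn R n -> R[i]),
     [/\ (0 < n)%N, L1 f & F = tensor chiI f]].

(* [j] exhibits the Banach space [B] as the completion of [L1_union] for the
   norm ||f (x) (x)_{k >= n} chi_I|| = ||f||_1.  The elements of [L1_union] are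
   functions, not classes modulo a.e. equality, so [j] need not be injective:
   it identifies two functions exactly when their difference has norm 0. *)
Record is_L1_completion (B : completeNormedModType R[i])
    (j : ((nat -> R) -> R[i]) -> B) : Prop := {
  completion_linear : forall (a : R[i]) (F G : (nat -> R) -> R[i]),
    L1_union F -> L1_union G ->
    j (fun x => a * F x + G x) = a *: j F + j G ;
  completion_norm : forall n (f : Rn R n -> R[i]), (0 < n)%N -> L1 f ->
    `|j (tensor chiI f)| = (L1norm f)%:C ;
  completion_dense : dense (j @` L1_union) }.

Definition C0_union : set ((nat -> R) -> R[i]) :=
  [set G | exists n (g : Rn R n -> R[i]),
     [/\ (0 < n)%N, C0 g & G = tensor hhat g]].

Definition supnorm (G : (nat -> R) -> R[i]) : \bar R :=
  ereal_sup (range (fun x => (Normc.normc (G x))%:E)).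

Definition C0_closure : set ((nat -> R) -> R[i]) :=
  [set G | forall e : R, 0 < e ->
     exists2 G', C0_union G' & (supnorm (fun x => (G x - G' x)%R) < e%:E)%E].

End spaces.

(* Main.v *)
Require Import Defs.
From HB Require Import structures.
From mathcomp Require Import all_boot all_order all_algebra.
From mathcomp Require Import complex finmap.
From mathcomp Require Import all_classical all_reals all_analysis.
From mathcomp Require Import measurable_realfun.
From mathcomp Require Import ring lra.

(** Two facts about R^n carry the theorem.  The n-dimensional Fourier transform
    maps L^1 into C_0 with sup norm at most a constant times the L^1 norm, and
    it turns f (x) chi_I into F(f) (x) hhat because hhat is the transform of
    chi_I.  By the second fact all the levels n can be compared: a function of
    the union lying on level n also lies on every higher level, with the same
    transform.  So the difference of two functions of the union may be taken on
    a common level, which makes the transform additive on the union and bounded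
    for the norm of the completion; density of the union then gives a unique
    bounded linear extension, whose values are uniform limits of functions
    tensor hhat g with g in C_0.

    Everything about the transform is read off the real integrals of
    f(y) cos(2 pi x.y + c), the sine being the cosine with phase -pi/2
    ([wave], [fourier_wave]).  Continuity is dominated convergence.  Vanishing
    at infinity, the Riemann-Lebesgue lemma, is proved for sequences x_k one of
    whose coordinates tends to infinity in absolute value ([oscillates_phase]):
    for bounded functions phi_k, the property that the integrals of f phi_k tend to 0 passes from the
    indicators of a generating pi-system to all integrable f
    ([pairing_cvg0_pi_system]).  Bounded intervals serve on the line, where the
    integral is explicit, and measurable rectangles serve on R x R^n, where the
    addition formula for cos splits the integral into products of integrals,
    one factor of which tends to 0 ([oscillates_prod]).

    Since [lebesgue_tuple] adds new coordinates in front while a tensor product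
    f (x) chi_I adds one at the end, the second fact needs the Lebesgue measure
    on R^(n+1) to be also the image of that on R^n x R by appending
    ([lebesgue_tuple_snocT]), which is Tonelli's theorem applied repeatedly.

    The extension ([exists_linear_extension]) is constructed pointwise: an
    approximation of u by b determines the value at u up to an error
    proportional to the norm of u - b, and real numbers compatible with all
    these constraints exist by completeness of R. *)

Import Order.TTheory GRing.Theory Num.Theory.
Import numFieldNormedType.Exports.

Local Open Scope classical_set_scope.
Local Open Scope ring_scope.
Local Open Scope complex_scope.

Set Implicit Arguments.
Unset Strict Implicit.
Unset Printing Implicit Defensive.

(** * Integrals against bounded functions *)

Section integrals.
Context d (X : measurableType d) (R : realType).
Variable mu : {measure set X -> \bar R}.
Implicit Types f g h : X -> R.

Lemma integrableM_le1 f h : mu.-integrable setT (EFin \o f) ->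
  measurable_fun setT h -> (forall x, `|h x| <= 1) ->
  mu.-integrable setT (EFin \o (f \* h)).
Proof.
move=> fi mh h1; apply: (le_integrable _ _ _ fi) => //.
  apply/measurable_EFinP; apply: measurable_funM => //.
  by apply/measurable_EFinP; exact: measurable_int fi.
by move=> x _; rewrite /= lee_fin normrM ler_piMr.
Qed.

Lemma norm_Rintegral_le_norm f h : mu.-integrable setT (EFin \o f) ->
  measurable_fun setT h -> (forall x, `|h x| <= 1) ->
  `|\int[mu]_x (f x * h x)| <= \int[mu]_x `|f x|.
Proof.
move=> fi mh h1; have fhi := integrableM_le1 fi mh h1.
apply: (le_trans (le_normr_Rintegral measurableT fhi)).
apply: le_Rintegral => //; do ?exact: integrable_norm.
by move=> x _; rewrite normrM ler_piMr.
Qed.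

Lemma Rintegral_dominated_cvg (f_ : nat -> X -> R) f g :
  (forall n, measurable_fun setT (f_ n)) ->
  (forall x, f_ ^~ x @ \oo --> f x) ->
  mu.-integrable setT (EFin \o g) -> (forall n x, `|f_ n x| <= g x) ->
  \int[mu]_x (f_ n x) @[n --> \oo] --> \int[mu]_x (f x).
Proof.
move=> mf ff gi fg; apply: fine_cvg.
have fi : mu.-integrable setT (EFin \o f).
  apply: (le_integrable _ _ _ gi) => //.
    by apply/measurable_EFinP; apply: (measurable_fun_cvg mf) => x _.
  move=> x _ /=; rewrite lee_fin (@le_trans _ _ (g x)) ?ler_norm//.
  by apply: (cvgr_to_le (cvg_norm (ff x))); apply: nearW => n; exact: fg.
rewrite fineK; last exact: integrable_fin_num.
apply: (@dominated_cvg _ _ _ _ _ _ _ _ (EFin \o g)) => //.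
- by move=> n; exact/measurable_EFinP.
- by move=> x _; apply: cvg_EFin; [exact: nearW|exact: ff].
- by move=> n x _; rewrite /= lee_fin.
Qed.

End integrals.

(** * Sequences of bounded functions whose integrals tend to 0 *)

Section weak_convergence.
Context d (X : measurableType d) (R : realType).
Variables (mu : {measure set X -> \bar R}) (phi : nat -> X -> R).
Hypotheses (mphi : forall k, measurable_fun setT (phi k))
  (phi1 : forall k x, `|phi k x| <= 1).
Implicit Types f g h : X -> R.

Definition pairing_cvg0 f := \int[mu]_x (f x * phi k x) @[k --> \oo] --> 0.

Lemma pairing_cvg0D f g :
  mu.-integrable setT (EFin \o f) -> mu.-integrable setT (EFin \o g) ->
  pairing_cvg0 f -> pairing_cvg0 g -> pairing_cvg0 (f \+ g).
Proof.
move=> fi gi f0 g0; rewrite /pairing_cvg0.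
rewrite [X in X @ _](_ : _ =
    (fun k => \int[mu]_x (f x * phi k x) + \int[mu]_x (g x * phi k x))).
  by rewrite -(addr0 0); exact: cvgD.
apply/funext => k; rewrite -RintegralD//; try exact: integrableM_le1.
by apply: eq_Rintegral => x _; rewrite mulrDl.
Qed.

Lemma pairing_cvg0Z r f : mu.-integrable setT (EFin \o f) ->
  pairing_cvg0 f -> pairing_cvg0 (fun x => r * f x).
Proof.
move=> fi f0; rewrite /pairing_cvg0.
rewrite [X in X @ _](_ : _ = (fun k => r * \int[mu]_x (f x * phi k x))).
  by rewrite -(mulr0 r); exact: cvgMl_tmp.
apply/funext => k; rewrite -RintegralZl//; try exact: integrableM_le1.
by apply: eq_Rintegral => x _; rewrite mulrA.
Qed.

(** The error of replacing f by g_n is at most the L^1 distance, uniformly in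
    k, because the phi_k are bounded by 1. *)
Lemma pairing_cvg0_L1_closed f (g_ : nat -> X -> R) :
  mu.-integrable setT (EFin \o f) ->
  (forall n, mu.-integrable setT (EFin \o g_ n)) ->
  (forall n, pairing_cvg0 (g_ n)) ->
  \int[mu]_x `|f x - g_ n x| @[n --> \oo] --> 0 -> pairing_cvg0 f.
Proof.
move=> fi gi g0 fg; apply/cvgr0Pnorm_lt => e e0.
have e20 : 0 < e / 2 by rewrite divr_gt0.
have /cvgr0Pnorm_lt/(_ _ e20)[n _ /(_ n (leqnn n)) Hn] := fg.
have /cvgr0Pnorm_lt/(_ _ e20) := g0 n; apply: filterS => k Hk.
have fgi : mu.-integrable setT (EFin \o (f \- g_ n)).
  by have := integrableB measurableT fi (gi n).
rewrite (_ : \int[mu]_x (f x * phi k x) =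
  \int[mu]_x ((f \- g_ n) x * phi k x) + \int[mu]_x (g_ n x * phi k x)).
  rewrite (le_lt_trans (ler_normD _ _))// [ltRHS]splitr ltrD//.
  rewrite (le_lt_trans (norm_Rintegral_le_norm fgi (mphi k) (phi1 k)))//.
  exact: le_lt_trans (ler_norm _) Hn.
rewrite -RintegralD//; try exact: integrableM_le1.
by apply: eq_Rintegral => x _ /=; rewrite mulrBl subrK.
Qed.

(** Dominated pointwise convergence implies convergence in L^1; this is the form
    in which closedness is applied to increasing unions of sets and to
    truncations. *)
Lemma pairing_cvg0_dominated f (g_ : nat -> X -> R) g :
  mu.-integrable setT (EFin \o g) -> (forall n, measurable_fun setT (g_ n)) ->
  (forall n x, `|g_ n x| <= g x) -> (forall x, g_ ^~ x @ \oo --> f x) ->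
  (forall n, pairing_cvg0 (g_ n)) -> pairing_cvg0 f.
Proof.
move=> gi mg gg gf g0.
have g_i n : mu.-integrable setT (EFin \o g_ n).
  apply: (le_integrable _ _ _ gi) => //; first exact/measurable_EFinP.
  by move=> x _; rewrite /= lee_fin (le_trans (gg n x))// ler_norm.
have mf : measurable_fun setT f by apply: (measurable_fun_cvg mg) => x _.
have fg x : `|f x| <= g x.
  by apply: (cvgr_to_le (cvg_norm (gf x))); apply: nearW => n; exact: gg.
have fi : mu.-integrable setT (EFin \o f).
  apply: (le_integrable _ _ _ gi) => //; first exact/measurable_EFinP.
  by move=> x _; rewrite /= lee_fin (le_trans (fg x))// ler_norm.
apply: (pairing_cvg0_L1_closed fi g_i g0).
rewrite [X in _ --> X](_ : 0 = \int[mu]_x `|f x - f x|); last first.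
  rewrite (_ : (fun x => _) = cst 0) ?Rintegral_cst ?mul0r//.
  by apply/funext => x /=; rewrite subrr normr0.
apply: (@Rintegral_dominated_cvg _ _ _ _ _ _ (fun x => 2 * g x)).
- move=> n; apply: measurableT_comp => //; exact: measurable_funB.
- move=> x; apply: cvg_norm; apply: cvgB => //; exact: cvg_cst.
- by have := integrableZl measurableT 2 gi.
- move=> n x; rewrite normr_id (le_trans (ler_normB _ _))// mulr_natl mulr2n.
  by rewrite lerD.
Qed.

End weak_convergence.

Section pi_system_test.
Import HBSimple.
Context d (X : measurableType d) (R : realType).
Variables (mu : {measure set X -> \bar R}) (phi : nat -> X -> R).
Hypotheses (mphi : forall k, measurable_fun setT (phi k))
  (phi1 : forall k x, `|phi k x| <= 1).
Implicit Types f g h : X -> R.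

Lemma pairing_cvg0_ext f g : f =1 g -> pairing_cvg0 mu phi f -> pairing_cvg0 mu phi g.
Proof. by move=> /funext ->. Qed.

Lemma integrable_indic_lty (A : set X) : measurable A -> (mu A < +oo)%E ->
  mu.-integrable setT (EFin \o (\1_A : X -> R)).
Proof.
move=> mA Aoo; apply/integrableP; split.
  by apply/measurable_EFinP; exact: measurable_indic.
rewrite (eq_integral (fun x => (\1_A x)%:E)); last first.
  by move=> x _; rewrite gee0_abs// lee_fin.
by rewrite integral_indic// setIT.
Qed.

Lemma pairing_cvg0_sum (I : Type) (s : seq I) (F : I -> X -> R) :
  (forall i, mu.-integrable setT (EFin \o F i)) ->
  (forall i, pairing_cvg0 mu phi (F i)) ->
  pairing_cvg0 mu phi (fun x => \sum_(i <- s) F i x).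
Proof.
move=> Fi F0.
suff [] : mu.-integrable setT (EFin \o (fun x => \sum_(i <- s) F i x)) /\
  pairing_cvg0 mu phi (fun x => \sum_(i <- s) F i x) by [].
elim: s => [|i s [IHi IH0]].
  under eq_fun do rewrite big_nil; split; first exact: integrable0.
  rewrite /pairing_cvg0; under eq_fun do under eq_Rintegral do rewrite mul0r.
  rewrite (_ : (fun _ => _) = cst 0); first exact: cvg_cst.
  by apply/funext => k /=; rewrite Rintegral_cst// mul0r.
rewrite (_ : (fun x => _) = F i \+ (fun x => \sum_(j <- s) F j x)); last first.
  by apply/funext => x; rewrite big_cons.
by split; [have := integrableD measurableT (Fi i) IHi|exact: pairing_cvg0D].
Qed.

Variables (G : set (set X)) (H : nat -> set X).
Hypotheses (GE : @measurable _ X = <<s G >>) (GI : setI_closed G)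
  (mH : forall m, measurable (H m)) (ndH : nondecreasing_seq H)
  (HT : \bigcup_m H m = setT) (Hoo : forall m, (mu (H m) < +oo)%E)
  (H0 : forall m, pairing_cvg0 mu phi (\1_(H m)))
  (GH0 : forall A, G A -> forall m, pairing_cvg0 mu phi (\1_(A `&` H m))).

(** Inside a cover set H m of finite measure, the sets with this property form
    a lambda-system: differences are handled by linearity, increasing unions by
    domination by the indicator of H m. *)
Lemma pairing_cvg0_setI_cover (A : set X) m :
  measurable A -> pairing_cvg0 mu phi (\1_(A `&` H m)).
Proof.
have iIH B : measurable B -> mu.-integrable setT (EFin \o (\1_(B `&` H m) : X -> R)).
  move=> mB; apply: integrable_indic_lty; first exact: measurableI.
  apply: le_lt_trans (Hoo m); apply: le_measure; rewrite ?inE//.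
  exact: measurableI.
pose D := [set B | measurable B /\ pairing_cvg0 mu phi (\1_(B `&` H m))].
suff : <<s G >> `<=` D by move=> + mA; rewrite -GE => /(_ A mA)[].
apply: lambda_system_subset => //; last first.
  by move=> B GB; split; [rewrite GE; exact: sub_sigma_algebra|exact: GH0].
split => //.
- by split; [exact: measurableT|rewrite setTI].
- move=> B C CB [mB B0] [mC C0]; split; first exact: measurableD.
  apply: (@pairing_cvg0_ext
    (\1_(B `&` H m) \+ (fun x => -1 * (\1_(C `&` H m) : X -> R) x))).
    move=> x /=; rewrite !indicE 2!in_setI in_setI in_setD.
    have [xC|xC] := boolP (x \in C); last by rewrite andbT mulr0 addr0.
    have -> : x \in B by move: xC; rewrite !inE; exact: CB.
    by rewrite mulN1r subrr.
  apply: pairing_cvg0D => //; first exact: iIH.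
    by have := integrableZl measurableT (-1) (iIH _ mC).
  by apply: pairing_cvg0Z => //; exact: iIH.
- move=> F ndF DF; have mF n : measurable (F n) by have [] := DF n.
  split; first exact: bigcupT_measurable.
  apply: (@pairing_cvg0_dominated _ _ _ _ _ mphi phi1 _
    (fun n => \1_(F n `&` H m)) (\1_(H m))).
  + exact: integrable_indic_lty.
  + by move=> n; apply: measurable_indic; exact: measurableI.
  + move=> n x; rewrite !indicE in_setI ger0_norm// ler_nat.
    by case: (x \in H m); rewrite ?andbT ?andbF// leq_b1.
  + move=> x; rewrite !indicI/=; under eq_fun do rewrite indicI/=.
    apply: cvgMr_tmp; have [Fx|nFx] := pselect ((\bigcup_n F n) x).
      rewrite indicE mem_set//; have [k _ Fkx] := Fx.
      apply: cvg_near_cst; exists k => // l /= kl; rewrite indicE mem_set//.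
      by move: Fkx; apply/subsetPset/ndF.
    rewrite indicE memNset//; apply: cvg_near_cst; apply: nearW => l.
    by rewrite indicE memNset// => Flx; apply: nFx; exists l.
  + by move=> n; have [] := DF n.
Qed.

(** From sets one goes to simple functions on H m by linearity, to integrable
    functions on H m by density of simple functions in L^1, and to f itself by
    truncating to H m and letting m tend to infinity. *)
Lemma pairing_cvg0_pi_system f : mu.-integrable setT (EFin \o f) ->
  pairing_cvg0 mu phi f.
Proof.
move=> fi.
have mI m : measurable_fun setT (\1_(H m) : X -> R) by exact: measurable_indic.
have I1 m x : `|\1_(H m) x| <= 1 :> R.
  by rewrite indicE ger0_norm//; case: (_ \in _).
apply: (@pairing_cvg0_dominated _ _ _ _ _ mphi phi1 _
    (fun n => f \* \1_(H n)) (fun x => `|f x|)).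
- exact: integrable_norm.
- move=> n; apply: measurable_funM => //.
  by apply/measurable_EFinP; exact: measurable_int fi.
- by move=> n x; rewrite normrM ler_piMr.
- move=> x; have : setT x by []. rewrite -HT => -[k _ Hkx].
  apply: cvg_near_cst; exists k => // l /= kl; rewrite indicE mem_set ?mulr1//.
  by move: Hkx; apply/subsetPset/ndH.
move=> m.
have fmi := integrableS measurableT (mH m) (@subsetT _ _) fi.
have [g_ [gi _ gf]] := approximation_sfun_integrable (mH m) fmi.
have giH n : mu.-integrable setT (EFin \o (g_ n \* \1_(H m))).
  have := gi n; rewrite integrable_mkcond//; apply: eq_integrable => // x _.
  by rewrite /= patchE indicE; case: ifPn => _; rewrite ?mulr1 ?mulr0.
apply: (@pairing_cvg0_L1_closed _ _ _ _ _ mphi phi1 _ (fun n => g_ n \* \1_(H m))).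
- exact: integrableM_le1.
- exact: giH.
- move=> n; apply: (@pairing_cvg0_ext (fun x => \sum_(r <- fset_set (range (g_ n)))
      (r * (\1_(g_ n @^-1` [set r] `&` H m) : X -> R) x))).
    move=> x /=; rewrite [in RHS]fimfunE fsbig_finite//= mulr_suml.
    by apply: eq_bigr => r _; rewrite indicI mulrA.
  have mgr r : measurable (g_ n @^-1` [set r]) by [].
  have gri r : mu.-integrable setT
      (EFin \o (\1_(g_ n @^-1` [set r] `&` H m) : X -> R)).
    apply: integrable_indic_lty; first exact: measurableI.
    apply: le_lt_trans (Hoo m); apply: le_measure; rewrite ?inE//.
    exact: measurableI.
  apply: pairing_cvg0_sum => r; first by have := integrableZl measurableT r (gri r).
  by apply: pairing_cvg0Z => //; exact: pairing_cvg0_setI_cover.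
- move/fine_cvg : gf; apply: cvg_trans; apply: near_eq_cvg; apply: nearW => n.
  transitivity (\int[mu]_(x in H m) `|f x - g_ n x|); first by [].
  rewrite Rintegral_mkcond; apply: eq_Rintegral => x _.
  rewrite patchE /= indicE; case: ifPn => _; rewrite ?mulr1//.
  by rewrite !mulr0 subrr normr0.
Qed.

End pi_system_test.

(** * Integrals of cosines over intervals *)

Section interval_integrals.
Context {R : realType}.
Implicit Types a b c w : R.
Local Notation leb := (@lebesgue_measure R).

Lemma continuous_cos_affine w c : continuous (fun y : R => cos (w * y + c)).
Proof.
move=> y; apply: (@continuous_comp _ _ _ (fun y : R => w * y + c) cos).
  apply: cvgD; last exact: cvg_cst. apply: cvgMl_tmp; exact: cvg_id.
exact: continuous_cos.
Qed.

Lemma measurable_cos : measurable_fun setT (@cos R).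
Proof. by apply: continuous_measurable_fun; exact: continuous_cos. Qed.

Lemma Rintegral_cos_affine w c a b : w != 0 -> a < b ->
  \int[leb]_(y in `[a, b]) cos (w * y + c) =
    (sin (w * b + c) - sin (w * a + c)) / w.
Proof.
move=> w0 ab; rewrite /Rintegral.
pose F y := sin (w * y + c) / w.
have dF (y : R) : is_derive y 1 F (cos (w * y + c)).
  rewrite /F; apply: is_derive_eq.
  rewrite /GRing.scale/= mulr0 add0r addr0 mulr1.
  by rewrite mulrC mulfK.
rewrite (@continuous_FTC2 _ (fun y => cos (w * y + c)) F a b)//=.
- by rewrite /F mulrBl.
- by apply: continuous_subspaceT; exact: continuous_cos_affine.
- have cF y : {for y, continuous F}.
    by apply/differentiable_continuous/derivable1_diffP; apply: ex_derive.
  split; first by move=> y _; apply: ex_derive.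
  + exact/cvg_at_right_filter/cF.
  + exact/cvg_at_left_filter/cF.
- by move=> y _; rewrite derive1E derive_val.
Qed.

End interval_integrals.

(** * Oscillating phases *)

Section oscillation.
Context d (X : measurableType d) (R : realType).
Variable mu : {measure set X -> \bar R}.

(** Quantifying over the constant c puts sines and cosines on the same footing,
    so that the addition formula stays within the property. *)
Definition oscillates (theta : nat -> X -> R) := forall (c : R) (f : X -> R),
  mu.-integrable setT (EFin \o f) ->
  pairing_cvg0 mu (fun k x => cos (theta k x + c)) f.

Lemma measurable_cos_phase (theta : X -> R) c : measurable_fun setT theta ->
  measurable_fun setT (fun x => cos (theta x + c)).
Proof.
move=> mt; apply: (measurableT_comp measurable_cos).
exact: measurable_funD.
Qed.

End oscillation.

Section oscillation_real_line.
Context {R : realType}.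
Local Notation leb := (@lebesgue_measure R).

Lemma norm_Rintegral_cos_itv_le (w c a b : R) : w != 0 ->
  `|\int[leb]_(y in `]a, b]) cos (w * y + c)| <= 2 / `|w|.
Proof.
move=> w0; have [ab|ba] := ltP a b; last first.
  by rewrite set_itv_ge ?bnd_simp -?leNgt// Rintegral_set0 normr0 divr_ge0.
rewrite Rintegral_itv_obnd_cbnd; last first.
  have /integrableS := continuous_compact_integrable
    (@segment_compact R a b) (continuous_subspaceT (@continuous_cos_affine R w c)).
  by apply => //; apply: subset_itvr; rewrite bnd_simp.
rewrite Rintegral_cos_affine// normrM normfV ler_pM2r ?invr_gt0 ?normr_gt0//.
by rewrite (le_trans (ler_normB _ _))// -[leRHS]/(1 + 1) lerD// sin_max.
Qed.

(** The Riemann-Lebesgue lemma on the line: over a bounded interval the integral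
    of cos (w y + c) is at most 2 / |w|. *)
Lemma oscillates_line (w : nat -> R) :
  (forall M, \forall k \near \oo, M < `|w k|) ->
  oscillates leb (fun k y => w k * y).
Proof.
move=> woo c f fi.
pose phi k (y : measurableTypeR R) := cos (w k * y + c).
have mphi k : measurable_fun setT (phi k).
  by apply: continuous_measurable_fun; exact: continuous_cos_affine.
have phi1 k y : `|phi k y| <= 1 by exact: cos_max.
have itv0 (a b : R) : pairing_cvg0 leb phi (\1_(`]a, b]%classic)).
  apply/cvgr0Pnorm_lt => e e0.
  (* |w k| > 2 / e makes 2 / |w k| < e, and |w k| > 0 makes w k nonzero. *)
  apply: filterS (woo (Num.max 0 (2 / e))) => k; rewrite gt_max => /andP[wk0 wke].
  rewrite (_ : \int[leb]_x _ = \int[leb]_(y in `]a, b]) cos (w k * y + c)).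
    apply: (le_lt_trans (norm_Rintegral_cos_itv_le _ _ _ _)).
      by rewrite -normr_gt0.
    by rewrite ltr_pdivrMr// mulrC -ltr_pdivrMr.
  rewrite [RHS]Rintegral_mkcond; apply: eq_Rintegral => y _.
  by rewrite patchE indicE; case: ifPn => _; rewrite ?mul1r ?mul0r.
pose H m : set (measurableTypeR R) := `](- m%:R : R), m%:R]%classic.
refine (@pairing_cvg0_pi_system _ _ _ leb phi mphi phi1 (@ocitv R) H
  erefl (@ocitvI R) _ _ _ _ _ _ f fi).
- by move=> m; exact: measurable_itv.
- move=> m n mn; apply/subsetPset; apply: subset_itv; rewrite bnd_simp.
    by rewrite lerN2 ler_nat.
  by rewrite ler_nat.
- apply/seteqP; split => // y _; exists (Num.truncn `|y|).+1 => //=.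
  have := truncnS_gt `|y|; rewrite /H/= in_itv/= ltr_norml => /andP[-> ?]/=.
  exact: ltW.
- move=> m; rewrite [ltLHS](lebesgue_measure_itv `]- m%:R, m%:R]%R)/=; case: ifP => // _.
  by rewrite -EFinB ltry.
- by move=> m; exact: itv0.
- move=> A ocA m; have [[a b] _ /= <-] := ocitvI ocA (is_ocitv (- m%:R) m%:R).
  exact: itv0.
Qed.

End oscillation_real_line.

(** An image measure is given by an equation between set functions, since the
    measures to which these lemmas apply are not syntactically of the form
    [pushforward mu g]. *)
Section image_measure.
Context d1 d2 (X : measurableType d1) (Y : measurableType d2) (R : realType).
Variables (mu : {measure set X -> \bar R}) (nu : {measure set Y -> \bar R}).
Variable g : X -> Y.
Hypotheses (mg : measurable_fun setT g)
  (nuE : forall A, measurable A -> nu A = mu (g @^-1` A)).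

Lemma ge0_integral_image (f : Y -> \bar R) : measurable_fun setT f ->
  (forall y, (0 <= f y)%E) -> (\int[nu]_y f y = \int[mu]_x f (g x))%E.
Proof.
move=> mf f0; apply: etrans (ge0_integral_pushforward mg mu measurableT mf _).
  by apply: eq_measure_integral => A mA _; exact: nuE.
by move=> y _; exact: f0.
Qed.

Implicit Types f : Y -> R.

Lemma integrable_image f : nu.-integrable setT (EFin \o f) <->
  measurable_fun setT f /\ mu.-integrable setT (EFin \o (f \o g)).
Proof.
split=> [/integrableP[mf foo]|[mf /integrableP[_ foo]]].
  split; first exact/measurable_EFinP.
  apply/integrableP; split; first exact: measurableT_comp mf mg.
  by move: foo; rewrite ge0_integral_image//; exact: measurableT_comp.
apply/integrableP; split; first exact/measurable_EFinP.
rewrite ge0_integral_image//.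
by apply: measurableT_comp => //; exact/measurable_EFinP.
Qed.

Lemma Rintegral_image f : nu.-integrable setT (EFin \o f) ->
  \int[nu]_y f y = \int[mu]_x f (g x).
Proof.
move=> fi; have [mf fgi] := (integrable_image f).1 fi.
have mEf : measurable_fun setT (EFin \o f) by exact/measurable_EFinP.
congr fine; apply: etrans (integral_pushforward mg mEf fgi measurableT).
by apply: eq_measure_integral => A mA _; exact: nuE.
Qed.

Lemma oscillates_image (theta : nat -> Y -> R) :
  (forall k, measurable_fun setT (theta k)) ->
  oscillates mu (fun k x => theta k (g x)) -> oscillates nu theta.
Proof.
move=> mt ot c f fi; have := ot c _ ((integrable_image f).1 fi).2.
apply: cvg_trans; apply: near_eq_cvg; apply: nearW => k.
rewrite Rintegral_image//.
apply: integrableM_le1 => //; first exact: measurable_cos_phase.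
by move=> x; exact: cos_max.
Qed.

End image_measure.

(** * Integrals over products *)

Section product_integrals.
Context d1 d2 (X : measurableType d1) (Y : measurableType d2) (R : realType).
Variables (m1 : {sigma_finite_measure set X -> \bar R})
  (m2 : {sigma_finite_measure set Y -> \bar R}).
Implicit Types (f : X -> R) (g : Y -> R).

Lemma integrable_tensor f g :
  m1.-integrable setT (EFin \o f) -> m2.-integrable setT (EFin \o g) ->
  (m1 \x m2)%E.-integrable setT (EFin \o (fun p => f p.1 * g p.2)).
Proof.
move=> fi gi.
have mf : measurable_fun setT f by apply/measurable_EFinP; exact: measurable_int fi.
have mg : measurable_fun setT g by apply/measurable_EFinP; exact: measurable_int gi.
apply/integrable12ltyP.
  apply/measurable_EFinP; apply: measurable_funM.
    exact: measurableT_comp.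
  exact: measurableT_comp.
have fai := integrable_abse fi; have gai := integrable_abse gi.
rewrite (_ : \int[m1]_x _ = \int[m1]_x (`|f x|%:E * \int[m2]_y `|(g y)%:E|))%E.
  rewrite ge0_integralZr//; last 2 first.
  - by apply/measurable_EFinP; exact: measurableT_comp.
  - exact: integral_ge0.
  have /integrableP[_ foo] := fi; have /integrableP[_ goo] := gi.
  rewrite lte_mul_pinfty// ?integral_ge0//.
  by rewrite ge0_fin_numE// integral_ge0.
apply: eq_integral => x _; rewrite -ge0_integralZl//; last first.
  by apply/measurable_EFinP; exact: measurableT_comp.
by apply: eq_integral => y _ /=; rewrite normrM EFinM.
Qed.

Lemma Rintegral_tensor f g :
  m1.-integrable setT (EFin \o f) -> m2.-integrable setT (EFin \o g) ->
  \int[(m1 \x m2)%E]_p (f p.1 * g p.2) = \int[m1]_x f x * \int[m2]_y g y.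
Proof.
move=> fi gi; rewrite {1}/Rintegral -integral12_prod_meas1; last first.
  exact: integrable_tensor.
rewrite /fubini_F -RintegralZr//; congr fine.
apply: eq_integral => x _ /=; rewrite EFinM.
under eq_integral do rewrite EFinM.
rewrite integralZl// /Rintegral fineK//.
exact: integrable_fin_num.
Qed.

Variables (alpha : nat -> X -> R) (beta : nat -> Y -> R).
Hypotheses (malpha : forall k, measurable_fun setT (alpha k))
  (mbeta : forall k, measurable_fun setT (beta k)).

(** The addition formula cos (s + t) = cos s cos t - sin s sin t, with the sines
    written as cosines shifted by pi / 2. *)
Lemma Rintegral_tensor_cosD f g (a : X -> R) (b : Y -> R) c :
  measurable_fun setT a -> measurable_fun setT b ->
  m1.-integrable setT (EFin \o f) -> m2.-integrable setT (EFin \o g) ->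
  \int[(m1 \x m2)%E]_p (f p.1 * g p.2 * cos (a p.1 + b p.2 + c)) =
    \int[m1]_x (f x * cos (a x + c)) * \int[m2]_y (g y * cos (b y + 0)) -
    \int[m1]_x (f x * cos (a x + (c - pi / 2))) *
    \int[m2]_y (g y * cos (b y - pi / 2)).
Proof.
move=> ma mb fi gi.
have fc c' : m1.-integrable setT (EFin \o (f \* (fun x => cos (a x + c')))).
  by apply: integrableM_le1 => // [|x]; [exact: measurable_cos_phase|exact: cos_max].
have gc c' : m2.-integrable setT (EFin \o (g \* (fun x => cos (b x + c')))).
  by apply: integrableM_le1 => // [|x]; [exact: measurable_cos_phase|exact: cos_max].
rewrite -(Rintegral_tensor (fc c) (gc 0)).
rewrite -(Rintegral_tensor (fc (c - pi / 2)) (gc (- (pi / 2)))).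
rewrite -RintegralB//; try exact: integrable_tensor.
apply: eq_Rintegral => -[x y] _ /=.
rewrite addr0 [a x + (c - _)]addrA !cosBpihalf [a x + b y + c]addrAC [cos (_ + b y)]cosD.
by ring.
Qed.

(** On a rectangle both terms of the addition formula are products of a factor
    tending to 0, from the oscillating phase, and of a bounded factor. *)
Lemma oscillates_prod : oscillates m1 alpha \/ oscillates m2 beta ->
  oscillates (m1 \x m2)%E (fun k p => alpha k p.1 + beta k p.2).
Proof.
move=> ab c f fi.
have bnd (d : measure_display) (Z : measurableType d) (m : {measure set Z -> \bar R})
    (g : Z -> R) (theta : nat -> Z -> R) c' :
    (forall k, measurable_fun setT (theta k)) -> m.-integrable setT (EFin \o g) ->
    forall k, `|\int[m]_x (g x * cos (theta k x + c'))| <= \int[m]_x `|g x|.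
  move=> mt gi k; apply: norm_Rintegral_le_norm => // [|x]; last exact: cos_max.
  exact: measurable_cos_phase.
(* The bound M may be 0, hence the division by M + 1. *)
have prod0 (u v : nat -> R) (M : R) :
    u k @[k --> \oo] --> 0 -> (forall k, `|v k| <= M) ->
    u k * v k @[k --> \oo] --> 0.
  move=> u0 vM; apply/cvgr0Pnorm_lt => e e0.
  have M0 : 0 <= M by exact: le_trans (vM 0%N).
  have e1 : 0 < e / (M + 1) by rewrite divr_gt0// ltr_wpDl.
  have /cvgr0Pnorm_lt/(_ _ e1) := u0; apply: filterS => k uk.
  rewrite normrM (@le_lt_trans _ _ (`|u k| * (M + 1)))//.
    by rewrite ler_wpM2l// (le_trans (vM k))// lerDl.
  by rewrite -ltr_pdivlMr// ltr_wpDl.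
have tens (g : X -> R) (h : Y -> R) : m1.-integrable setT (EFin \o g) -> m2.-integrable setT (EFin \o h) ->
    pairing_cvg0 (m1 \x m2)%E (fun k p => cos (alpha k p.1 + beta k p.2 + c))
      (fun p => g p.1 * h p.2).
  move=> gi hi; rewrite /pairing_cvg0.
  under eq_fun do rewrite Rintegral_tensor_cosD//.
  rewrite -(subr0 0); case: ab => [a0|b0].
    by apply: cvgB; apply: prod0; try exact: a0; exact: bnd.
  under eq_fun do rewrite mulrC [X in _ - X]mulrC.
  by apply: cvgB; apply: prod0; try exact: b0; exact: bnd.
have /sigma_finiteP[F [FT ndF Foo]] := sigma_finiteT m1.
have /sigma_finiteP[H [HT ndH Hoo]] := sigma_finiteT m2.
have rect A B m : measurable A -> measurable B ->
    pairing_cvg0 (m1 \x m2)%E (fun k p => cos (alpha k p.1 + beta k p.2 + c))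
      (\1_((A `*` B) `&` (F m `*` H m))).
  move=> mA mB; have [mF Fmoo] := Foo m; have [mH Hmoo] := Hoo m.
  have := tens (\1_(A `&` F m)) (\1_(B `&` H m)).
  rewrite -setXI (_ : \1_(_ `*` _) =
      (fun p => \1_(A `&` F m) p.1 * \1_(B `&` H m) p.2)).
    apply.
    - apply: integrable_indic_lty; first exact: measurableI.
      by apply: le_lt_trans Fmoo; rewrite le_measure ?inE//; exact: measurableI.
    - apply: integrable_indic_lty; first exact: measurableI.
      by apply: le_lt_trans Hmoo; rewrite le_measure ?inE//; exact: measurableI.
  by apply/funext => p; rewrite !indicE in_setX -natrM mulnb.
pose C := [set A `*` B | A in @measurable _ X & B in @measurable _ Y].
refine (@pairing_cvg0_pi_system _ _ _ (m1 \x m2)%E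
  (fun k p => cos (alpha k p.1 + beta k p.2 + c)) _ _ C
  (fun m => F m `*` H m) _ _ _ _ _ _ _ _ f fi).
- move=> k; apply: measurable_cos_phase; apply: measurable_funD.
    exact: measurableT_comp.
  exact: measurableT_comp.
- by move=> k p; exact: cos_max.
- exact: measurable_prod_measurableType.
- move=> _ _ [A1 mA1 [B1 mB1 <-]] [A2 mA2 [B2 mB2 <-]].
  exists (A1 `&` A2); first exact: measurableI.
  exists (B1 `&` B2); first exact: measurableI.
  by rewrite setXI.
- by move=> m; apply: measurableX; [have [] := Foo m|have [] := Hoo m].
- move=> m n mn; apply/subsetPset => -[x y] [/= Fx Hy]; split => /=.
    by move: Fx; apply/subsetPset/ndF.
  by move: Hy; apply/subsetPset/ndH.
- apply/seteqP; split=> // -[x y] _.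
  have : setT x by []. have : setT y by [].
  rewrite {1}HT {1}FT => -[l _ Hly] [k _ Fkx].
  exists (maxn k l) => //; split=> /=.
    by move: Fkx; exact/subsetPset/ndF/leq_maxl.
  by move: Hly; exact/subsetPset/ndH/leq_maxr.
- move=> m; have [mF Fmoo] := Foo m; have [mH Hmoo] := Hoo m.
  by rewrite /= product_measure1E// lte_mul_pinfty// ge0_fin_numE.
- by move=> m; rewrite -[X in \1_X]setTI -setXTT; exact: rect.
- by move=> _ [A mA [B mB <-]] m; exact: rect.
Qed.

End product_integrals.

(** * Lebesgue measure and phases on tuples *)

Section tuples.
Context {R : realType}.
Local Notation T := (measurableTypeR R).
Local Notation leb := (@lebesgue_measure R).
Local Notation Leb n := (@lebesgue_tuple R n).

Definition phase n (x y : Rn R n) : R :=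
  2 * pi * \sum_(i < n) tnth x i * tnth y i.

Lemma measurable_phase n (x : Rn R n) : measurable_fun setT (phase x).
Proof.
apply: measurable_funM => //; apply: measurable_sum => i.
apply: measurable_funM => //; exact: measurable_tnth.
Qed.

Lemma phase_consT n (x : Rn R n.+1) p :
  phase x (consT p) =
  (2 * pi * tnth x ord0) * p.1 + phase [tuple tnth x (lift ord0 i) | i < n] p.2.
Proof.
rewrite /phase big_ord_recl/= mulrDr mulrA; congr (_ + _ * _).
by apply: eq_bigr => i _; rewrite tnth_mktuple; congr (_ * _); rewrite !(tnth_nth 0).
Qed.

(** The Riemann-Lebesgue lemma on R^n, by induction on n: the diverging
    coordinate is either the first one, which oscillates by itself on the line,
    or a coordinate of the remaining tuple. *)
Lemma oscillates_phase n (x : nat -> Rn R n) (i : 'I_n) :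
  (forall M, \forall k \near \oo, M < `|tnth (x k) i|) ->
  oscillates (Leb n) (fun k => phase (x k)).
Proof.
elim: n => [|n IHn] in x i *; first by case: i.
move=> xoo; apply: (@oscillates_image _ _ _ _ _ (leb \x Leb n)%E (Leb n.+1)
    (@consT R n)) => //.
- exact: measurable_consT.
- by move=> k; exact: measurable_phase.
under eq_fun do under eq_fun do rewrite phase_consT.
apply: (@oscillates_prod _ _ _ _ _ leb (Leb n)
    (fun k y => 2 * pi * tnth (x k) ord0 * y)
    (fun k => phase [tuple tnth (x k) (lift ord0 i) | i < n])).
- by move=> k; exact: measurable_funM.
- by move=> k; exact: measurable_phase.
have [j ij|i0] := unliftP ord0 i; [right|left].
  apply: (IHn _ j) => M; apply: filterS (xoo M) => k.
  by rewrite tnth_mktuple -ij.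
apply: oscillates_line => M; have := xoo (M / (2 * pi)); apply: filterS => k.
have pi2 : 0 < 2 * pi :> R by rewrite mulr_gt0// pi_gt0.
by rewrite i0 ltr_pdivrMr// normrM mulrC (gtr0_norm pi2).
Qed.

Definition snocT n (p : n.-tuple T * T) : n.+1.-tuple T :=
  [the n.+1.-tuple T of rcons p.1 p.2].

Lemma tnth_snocT_widen n (p : n.-tuple T * T) (i : 'I_n) :
  tnth (snocT p) (widen_ord (leqnSn n) i) = tnth p.1 i.
Proof. by rewrite !(tnth_nth 0)/= nth_rcons size_tuple ltn_ord. Qed.

Lemma tnth_snocT_max n (p : n.-tuple T * T) : tnth (snocT p) ord_max = p.2.
Proof. by rewrite (tnth_nth 0)/= nth_rcons size_tuple ltnn eqxx. Qed.

Lemma measurable_snocT n : measurable_fun setT (@snocT n).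
Proof.
apply/measurable_fun_tnthP => i.
have [[j ->]|->] : (exists j, i = widen_ord (leqnSn n) j) \/ i = ord_max.
  have [iltn|] := ltnP i n; first by left; exists (Ordinal iltn); exact: val_inj.
  move=> ni; right; apply: val_inj => /=; apply/eqP.
  by rewrite eqn_leq ni -ltnS ltn_ord.
  rewrite (_ : _ \o _ = fun p => tnth p.1 j).
    by apply: (measurableT_comp (measurable_tnth j)); exact: measurable_fst.
  by apply/funext => p /=; exact: tnth_snocT_widen.
rewrite (_ : _ \o _ = snd) //.
by apply/funext => p /=; exact: tnth_snocT_max.
Qed.

Lemma snocT_consT n y0 (t : n.-tuple T) y :
  snocT (consT (y0, t), y) = consT (y0, snocT (t, y)).
Proof. exact: val_inj. Qed.

Lemma ge0_integral_consT n (F : Rn R n.+1 -> \bar R) :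
  measurable_fun setT F -> (forall t, (0 <= F t)%E) ->
  (\int[Leb n.+1]_t F t = \int[leb]_y \int[Leb n]_t F (consT (y, t)))%E.
Proof.
move=> mF F0.
rewrite (ge0_integral_image (mu := (leb \x Leb n)%E) (g := @consT R n))//.
  rewrite fubini_tonelli1// .
  exact: measurableT_comp mF (measurable_consT (n:=n)).
exact: measurable_consT.
Qed.

(** Peeling off the first coordinate on both sides leaves the induction hypothesis
    under an outer integral. *)
Lemma ge0_integral_snocT n (F : Rn R n.+1 -> \bar R) :
  measurable_fun setT F -> (forall t, (0 <= F t)%E) ->
  (\int[Leb n.+1]_t F t = \int[Leb n]_t \int[leb]_y F (snocT (t, y)))%E.
Proof.
have mint m (G : Rn R m.+1 -> \bar R) : measurable_fun setT G ->
    (forall t, (0 <= G t)%E) ->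
    measurable_fun setT (fun t : Rn R m => \int[leb]_y G (snocT (t, y)))%E.
  move=> mG G0; apply: (measurable_fun_fubini_tonelli_F (G \o @snocT m)).
    exact: measurableT_comp mG (@measurable_snocT m).
  by move=> p; exact: G0.
elim: n => [|n IHn] in F *; move=> mF F0; rewrite ge0_integral_consT//.
  rewrite /= integral_dirac//; last exact: mint.
  rewrite diracT mul1e; apply: eq_integral => y _.
  rewrite integral_dirac//; first by rewrite diracT mul1e; congr F; exact: val_inj.
  apply: measurableT_comp mF _.
  exact: measurableT_comp (@measurable_consT R 0) (measurable_pair1 y).
rewrite ge0_integral_consT//; last 2 first.
- exact: mint.
- by move=> t; exact: integral_ge0.
apply: eq_integral => y0 _; rewrite IHn//.
  by apply: eq_integral => t _; apply: eq_integral => y _; rewrite snocT_consT.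
apply: measurableT_comp mF _.
exact: measurableT_comp (@measurable_consT R n.+1) (measurable_pair1 y0).
Qed.

Lemma lebesgue_tuple_snocT n (A : set (Rn R n.+1)) : measurable A ->
  Leb n.+1 A = (Leb n \x leb)%E (@snocT n @^-1` A).
Proof.
move=> mA.
have mA' : measurable (@snocT n @^-1` A).
  by rewrite -[X in measurable X]setTI; exact: measurable_snocT.
transitivity (\int[Leb n.+1]_t (\1_A t)%:E)%E.
  by rewrite integral_indic// setIT.
rewrite ge0_integral_snocT//; last exact/measurable_EFinP.
transitivity (\int[(Leb n \x leb)%E]_p (\1_(@snocT n @^-1` A) p)%:E)%E.
  by rewrite fubini_tonelli1//; exact/measurable_EFinP.
by rewrite integral_indic// setIT.
Qed.

End tuples.

(** * Cosine integrals of integrable functions *)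

Section waves.
Context {R : realType}.
Local Notation T := (measurableTypeR R).
Local Notation leb := (@lebesgue_measure R).
Local Notation Leb n := (@lebesgue_tuple R n).

Definition wave n (c : R) (f : Rn R n -> R) (x : Rn R n) : R :=
  \int[Leb n]_y (f y * cos (phase x y + c)).

Lemma integrable_wave n c (f : Rn R n -> R) x :
  (Leb n).-integrable setT (EFin \o f) ->
  (Leb n).-integrable setT (EFin \o (fun y => f y * cos (phase x y + c))).
Proof.
move=> fi; apply: (integrableM_le1 fi) => [|y]; last exact: cos_max.
by apply: measurable_cos_phase; exact: measurable_phase.
Qed.

Lemma wave_le n c (f : Rn R n -> R) x :
  (Leb n).-integrable setT (EFin \o f) -> `|wave c f x| <= \int[Leb n]_y `|f y|.
Proof.
move=> fi; apply: (norm_Rintegral_le_norm fi) => [|y]; last exact: cos_max.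
by apply: measurable_cos_phase; exact: measurable_phase.
Qed.

Lemma wave_cvg n c (f : Rn R n -> R) (x : Rn R n) (x_ : nat -> Rn R n) :
  (Leb n).-integrable setT (EFin \o f) ->
  (forall i, tnth (x_ k) i @[k --> \oo] --> tnth x i) ->
  wave c f (x_ k) @[k --> \oo] --> wave c f x.
Proof.
move=> fi xx.
apply: (@Rintegral_dominated_cvg _ _ _ _ _ _ (fun y => `|f y|)).
- move=> k; apply: measurable_funM.
    by apply/measurable_EFinP; exact: measurable_int fi.
  by apply: measurable_cos_phase; exact: measurable_phase.
- move=> y; apply: cvgMl_tmp.
  apply: (continuous_cvg _ (@continuous_cos R (phase x y + c))).
  apply: cvgD; last exact: cvg_cst.
  apply: cvgMl_tmp; apply: cvg_big => [|i _]; first exact: add_continuous.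
  by apply: cvgMr_tmp; exact: xx.
- exact: integrable_norm.
- by move=> k y; rewrite normrM ler_piMr// cos_max.
Qed.

Lemma wave_cvg0 n c (f : Rn R n -> R) (x_ : nat -> Rn R n) i :
  (Leb n).-integrable setT (EFin \o f) ->
  (forall M, \forall k \near \oo, M < `|tnth (x_ k) i|) ->
  wave c f (x_ k) @[k --> \oo] --> 0.
Proof. by move=> fi xoo; apply: (oscillates_phase xoo). Qed.

(** This says that hhat is the Fourier transform of chi_I: the phases c = 0 and
    c = - pi / 2 give the real part hhat x and the imaginary part 0. *)
Lemma Rintegral_chiI_cos c (x : R) :
  \int[leb]_y (chiI y * cos (2 * pi * x * y + c)) = cos c * hhat x.
Proof.
transitivity (\int[leb]_(y in `[- 2^-1, 2^-1]) cos (2 * pi * x * y + c)).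
  rewrite [RHS]Rintegral_mkcond; apply: eq_Rintegral => y _.
  by rewrite patchE /chiI indicE; case: ifPn => _; rewrite ?mul1r ?mul0r.
have half : - 2^-1 < 2^-1 :> R by lra.
rewrite /hhat; case: eqVneq => [->|x0].
  under eq_Rintegral do rewrite mulr0 mul0r add0r.
  rewrite Rintegral_cst// [X in fine X](lebesgue_measure_itv `[- 2^-1, 2^-1]%R).
  rewrite /= lte_fin half mulr1 -EFinB /=; lra.
have pi0 : pi != 0 :> R by rewrite gt_eqF// pi_gt0.
rewrite Rintegral_cos_affine//; last by rewrite !mulf_neq0.
(* Only pi <> 0 matters from here on; pi is generalized so that the ring
   normalization does not unfold its definition. *)
move: (@pi R) pi0 => p p0.
have -> : 2 * p * x * 2^-1 + c = c + p * x by field.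
have -> : 2 * p * x * - 2^-1 + c = c - p * x by field.
by rewrite sinD sinB; field; rewrite x0.
Qed.

Definition initT n (t : Rn R n.+1) : Rn R n :=
  [tuple tnth t (widen_ord (leqnSn n) i) | i < n].

Lemma initT_snocT n (p : n.-tuple T * T) : initT (snocT p) = p.1.
Proof. by apply: eq_from_tnth => i; rewrite tnth_mktuple tnth_snocT_widen. Qed.

Lemma measurable_initT n : measurable_fun setT (@initT n).
Proof.
apply/measurable_fun_tnthP => i.
rewrite (_ : _ \o _ = fun t => tnth t (widen_ord (leqnSn n) i)).
  exact: measurable_tnth.
by apply/funext => t /=; rewrite tnth_mktuple.
Qed.

Lemma phase_snocT n (x : Rn R n.+1) p :
  phase x (snocT p) = phase (initT x) p.1 + 2 * pi * tnth x ord_max * p.2.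
Proof.
rewrite /phase big_ord_recr/= mulrDr mulrA tnth_snocT_max; congr (_ * _ + _).
by apply: eq_bigr => i _; rewrite tnth_mktuple tnth_snocT_widen.
Qed.

Lemma integrable_chiI : leb.-integrable setT (EFin \o (@chiI R)).
Proof. exact: (@integrable_indic_itv R (- 2^-1) 2^-1 true false). Qed.

Lemma integrable_snoc_chiI n (f : Rn R n -> R) :
  (Leb n).-integrable setT (EFin \o f) ->
  (Leb n.+1).-integrable setT
    (EFin \o (fun t => f (initT t) * chiI (tnth t ord_max))).
Proof.
move=> fi; apply/(integrable_image (@measurable_snocT R n) (@lebesgue_tuple_snocT R n)).
split.
  apply: measurable_funM.
    apply: (measurableT_comp (f := f)); last exact: measurable_initT.
    by apply/measurable_EFinP; exact: measurable_int fi.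
  apply: (measurableT_comp (f := @chiI R)); last exact: measurable_tnth.
  exact: measurable_indic.
rewrite (_ : _ \o @snocT R n = fun p => f p.1 * chiI p.2).
  exact: integrable_tensor fi integrable_chiI.
by apply/funext => p /=; rewrite initT_snocT tnth_snocT_max.
Qed.

(** In the addition formula for the last coordinate the sine term vanishes, as
    chi_I is even. *)
Lemma wave_snoc_chiI n c (f : Rn R n -> R) (x : Rn R n.+1) :
  (Leb n).-integrable setT (EFin \o f) ->
  wave c (fun t => f (initT t) * chiI (tnth t ord_max)) x =
    wave c f (initT x) * hhat (tnth x ord_max).
Proof.
move=> fi; rewrite {1}/wave (Rintegral_image (@measurable_snocT R n)
  (@lebesgue_tuple_snocT R n)); last exact/integrable_wave/integrable_snoc_chiI.
have := @Rintegral_tensor_cosD _ _ _ _ _ (Leb n) leb f (@chiI R)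
  (phase (initT x)) (fun y => 2 * pi * tnth x ord_max * y) c.
rewrite !Rintegral_chiI_cos cos0 cosN cos_pihalf mul1r mul0r mulr0 subr0 => <-//.
- apply: eq_Rintegral => p _.
  by rewrite initT_snocT tnth_snocT_max phase_snocT.
- exact: measurable_phase.
- exact: measurable_funM.
- exact: integrable_chiI.
Qed.

End waves.

(** * Real and imaginary parts *)

Section complex_numbers.
Context {R : realType}.
Implicit Types z : R[i].
Import Normc.

Lemma normr_normc z : `|z| = (normc z)%:C. Proof. by []. Qed.

Lemma ReD z z' : complex.Re (z + z') = complex.Re z + complex.Re z'.
Proof. by case: z z' => ? ? []. Qed.

Lemma ImD z z' : complex.Im (z + z') = complex.Im z + complex.Im z'.
Proof. by case: z z' => ? ? []. Qed.

Lemma ReM z z' : complex.Re (z * z') =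
  complex.Re z * complex.Re z' - complex.Im z * complex.Im z'.
Proof. by case: z z' => ? ? []. Qed.

Lemma ImM z z' : complex.Im (z * z') =
  complex.Re z * complex.Im z' + complex.Im z * complex.Re z'.
Proof. by case: z z' => ? ? []. Qed.

Lemma normr_Re_le z : `|complex.Re z| <= normc z.
Proof.
by case: z => a b /=; rewrite -sqrtr_sqr ler_wsqrtr// lerDl sqr_ge0.
Qed.

Lemma normr_Im_le z : `|complex.Im z| <= normc z.
Proof.
by case: z => a b /=; rewrite -sqrtr_sqr ler_wsqrtr// lerDr sqr_ge0.
Qed.

Lemma normc_le_ReIm z : normc z <= `|complex.Re z| + `|complex.Im z|.
Proof.
case: z => a b /=; rewrite -[leRHS]ger0_norm ?addr_ge0// -sqrtr_sqr ler_wsqrtr//.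
by rewrite sqrrD !real_normK ?num_real// lerD2r lerDl mulrn_wge0// mulr_ge0.
Qed.

Lemma normc_ge0 z : 0 <= normc z.
Proof. exact: le_trans (normr_Re_le z). Qed.

Lemma normc_real (r : R) : normc r%:C = `|r|.
Proof. by rewrite /= expr0n/= addr0 sqrtr_sqr. Qed.

End complex_numbers.

(** * The Fourier transform on tuples *)

Section fourier_transform.
Context {R : realType}.
Local Notation Leb n := (@lebesgue_tuple R n).
Import Normc.

Lemma fourier_wave n (f : Rn R n -> R[i]) x : L1 f ->
  fourier f x =
    (wave 0 (fun y => complex.Re (f y)) x +
      wave (- (pi / 2)) (fun y => complex.Im (f y)) x) +i*
    (wave 0 (fun y => complex.Im (f y)) x -
      wave (- (pi / 2)) (fun y => complex.Re (f y)) x).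
Proof.
move=> [rf jf]; rewrite /fourier /cintegral /wave; congr (_ +i* _).
- rewrite -RintegralD//; try exact: integrable_wave.
  apply: eq_Rintegral => y _; rewrite ReM /= cosN sinN addr0 cosBpihalf.
  by rewrite /phase; ring.
- rewrite -RintegralB//; try exact: integrable_wave.
  apply: eq_Rintegral => y _; rewrite ImM /= cosN sinN addr0 cosBpihalf.
  by rewrite /phase; ring.
Qed.

Lemma integrable_normc n (f : Rn R n -> R[i]) : L1 f ->
  (Leb n).-integrable setT (EFin \o (fun y => normc (f y))).
Proof.
move=> [rf jf]; have := integrableD measurableT
  (integrable_norm rf) (integrable_norm jf).
apply: le_integrable => //.
  have [mr mi] : measurable_fun setT (fun y => complex.Re (f y)) /\
      measurable_fun setT (fun y => complex.Im (f y)).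
    by split; apply/measurable_EFinP; [exact: measurable_int rf|exact: measurable_int jf].
  apply/measurable_EFinP.
  rewrite (_ : (fun y => _) = fun y =>
      Num.sqrt (complex.Re (f y) ^+ 2 + complex.Im (f y) ^+ 2)).
    apply: (measurableT_comp (continuous_measurable_fun (@sqrt_continuous R))).
    by apply: measurable_funD; exact: measurable_funX.
  by apply/funext => y; case: (f y).
move=> y _ /=; rewrite lee_fin ger0_norm ?normc_ge0//.
rewrite (le_trans (normc_le_ReIm _))//.
exact: ler_norm.
Qed.

(** The constant 4 counts the four real integrals of [fourier_wave], each at most
    the L^1 norm; any constant serves to extend the transform. *)
Lemma normc_fourier_le n (f : Rn R n -> R[i]) x : L1 f ->
  normc (fourier f x) <= 4 * L1norm f.
Proof.
move=> fL1; have ni := integrable_normc fL1; have [rf jf] := fL1.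
have wr c : `|wave c (fun y => complex.Re (f y)) x| <= L1norm f.
  apply: le_trans (wave_le _ _ rf) _; apply: le_Rintegral => //.
    exact: integrable_norm.
  by move=> y _; exact: normr_Re_le.
have wi c : `|wave c (fun y => complex.Im (f y)) x| <= L1norm f.
  apply: le_trans (wave_le _ _ jf) _; apply: le_Rintegral => //.
    exact: integrable_norm.
  by move=> y _; exact: normr_Im_le.
rewrite (le_trans (normc_le_ReIm _))// fourier_wave//=.
rewrite (le_trans (lerD (ler_normD _ _) (ler_normB _ _)))//.
rewrite (_ : 4 * L1norm f = L1norm f + L1norm f + (L1norm f + L1norm f)).
  by do 2?apply: lerD.
by ring.
Qed.

Lemma integrable_lincomb n (r s : R) (f g h : Rn R n -> R) :
  (Leb n).-integrable setT (EFin \o f) -> (Leb n).-integrable setT (EFin \o g) ->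
  (Leb n).-integrable setT (EFin \o h) ->
  (Leb n).-integrable setT (EFin \o (fun y => r * f y + s * g y + h y)).
Proof.
move=> fi gi hi.
have := integrableD measurableT (integrableD measurableT
  (integrableZl measurableT r fi) (integrableZl measurableT s gi)) hi.
exact.
Qed.

Lemma wave_lincomb n c (r s : R) (f g h : Rn R n -> R) x :
  (Leb n).-integrable setT (EFin \o f) -> (Leb n).-integrable setT (EFin \o g) ->
  (Leb n).-integrable setT (EFin \o h) ->
  wave c (fun y => r * f y + s * g y + h y) x =
    r * wave c f x + s * wave c g x + wave c h x.
Proof.
move=> fi gi hi; have fw := integrable_wave c x fi.
have gw := integrable_wave c x gi; have hw := integrable_wave c x hi.
rewrite /wave -!RintegralZl// -!RintegralD//.
- by apply: eq_Rintegral => y _; ring.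
- have := integrableD measurableT (integrableZl measurableT r fw)
    (integrableZl measurableT s gw).
  exact.
- by have := integrableZl measurableT r fw.
- by have := integrableZl measurableT s gw.
Qed.

Lemma L1_linear n (a : R[i]) (f g : Rn R n -> R[i]) : L1 f -> L1 g ->
  L1 (fun y => a * f y + g y).
Proof.
move=> [rf jf] [rg jg]; split.
  rewrite (_ : (fun y => _) = EFin \o (fun y => complex.Re a * complex.Re (f y) +
     (- complex.Im a) * complex.Im (f y) + complex.Re (g y))).
    exact: integrable_lincomb.
  by apply/funext => y /=; rewrite ReD ReM mulNr.
rewrite (_ : (fun y => _) = EFin \o (fun y => complex.Re a * complex.Im (f y) +
   complex.Im a * complex.Re (f y) + complex.Im (g y))).
  exact: integrable_lincomb.
by apply/funext => y /=; rewrite ImD ImM.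
Qed.

Lemma fourier_linear n (a : R[i]) (f g : Rn R n -> R[i]) x : L1 f -> L1 g ->
  fourier (fun y => a * f y + g y) x = a * fourier f x + fourier g x.
Proof.
move=> fL gL; have [rf jf] := fL; have [rg jg] := gL.
rewrite fourier_wave; last exact: L1_linear.
rewrite (fourier_wave _ fL) (fourier_wave _ gL).
have -> : (fun y => complex.Re (a * f y + g y)) = fun y =>
    complex.Re a * complex.Re (f y) + (- complex.Im a) * complex.Im (f y) +
    complex.Re (g y) by apply/funext => y /=; rewrite ReD ReM mulNr.
have -> : (fun y => complex.Im (a * f y + g y)) = fun y =>
    complex.Re a * complex.Im (f y) + complex.Im a * complex.Re (f y) +
    complex.Im (g y) by apply/funext => y /=; rewrite ImD ImM.
rewrite !wave_lincomb//; case: a => a b /=.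
apply/eqP; rewrite eq_complex ReD ReM ImD ImM /=; apply/andP; split.
  by apply/eqP; ring.
by apply/eqP; ring.
Qed.

Lemma fourier_cvg n (f : Rn R n -> R[i]) (x : Rn R n) (x_ : nat -> Rn R n) :
  L1 f -> (forall i, tnth (x_ k) i @[k --> \oo] --> tnth x i) ->
  normc (fourier f (x_ k) - fourier f x) @[k --> \oo] --> 0.
Proof.
move=> fL xx; have [rf jf] := fL.
pose u k := `|complex.Re (fourier f (x_ k)) - complex.Re (fourier f x)| +
            `|complex.Im (fourier f (x_ k)) - complex.Im (fourier f x)|.
apply: (@squeeze_cvgr _ _ _ _ (cst 0) u).
- by apply: nearW => k; apply/andP; split; [exact: normc_ge0|exact: normc_le_ReIm].
- exact: cvg_cst.
have dist0 (v : nat -> R) l : v k @[k --> \oo] --> l -> `|v k - l| @[k --> \oo] --> 0.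
  by move=> vl; rewrite -[X in _ --> X](@normr0 _ R) -(subrr l);
    apply: cvg_norm; apply: cvgB => //; exact: cvg_cst.
rewrite /u -(addr0 0); apply: cvgD; apply: dist0.
  under eq_fun do rewrite (fourier_wave _ fL); rewrite (fourier_wave _ fL) /=.
  by apply: cvgD; exact: wave_cvg.
under eq_fun do rewrite (fourier_wave _ fL); rewrite (fourier_wave _ fL) /=.
by apply: cvgB; exact: wave_cvg.
Qed.

Lemma fourier_cvg0 n (f : Rn R n -> R[i]) (x_ : nat -> Rn R n) i :
  L1 f -> (forall M, \forall k \near \oo, M < `|tnth (x_ k) i|) ->
  normc (fourier f (x_ k)) @[k --> \oo] --> 0.
Proof.
move=> fL xoo; have [rf jf] := fL.
pose u k := `|complex.Re (fourier f (x_ k))| + `|complex.Im (fourier f (x_ k))|.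
apply: (@squeeze_cvgr _ _ _ _ (cst 0) u).
- by apply: nearW => k; apply/andP; split; [exact: normc_ge0|exact: normc_le_ReIm].
- exact: cvg_cst.
rewrite /u -(addr0 0); apply: cvgD; rewrite -[X in _ --> X](@normr0 _ R);
  apply: cvg_norm; under eq_fun do rewrite (fourier_wave _ fL) /=.
  by rewrite -(addr0 0); apply: cvgD; exact: wave_cvg0 xoo.
by rewrite -(subr0 0); apply: cvgB; exact: wave_cvg0 xoo.
Qed.

End fourier_transform.

(** * The Fourier transform vanishes at infinity *)

Section vanishing.
Context {R : realType}.
Import Normc.

(** If continuity failed at v, a sequence converging to v would contradict the
    sequential statement. *)
Lemma continuous_fourier n (f : Rn R n -> R[i]) : L1 f ->
  continuous (fun v : 'rV[R]_n => fourier f (tuple_of_row v) : R[i]^o).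
Proof.
move=> fL v; apply/(@cvgrPdist_lt _ R[i]^o _ _ (nbhs_filter v)) => e e0.
apply: contrapT => near_v.
have Re_e : 0 < complex.Re e by move: e0; rewrite ltcE => /andP[].
have eE : e = (complex.Re e)%:C.
  by move: e0; rewrite ltcE => /andP[/eqP/= + _]; case: (e) => a b /= ->.
have bad k : exists w : 'rV[R]_n, ball v (k.+1%:R^-1 : R) w /\
    complex.Re e <= normc (fourier f (tuple_of_row w) - fourier f (tuple_of_row v)).
  apply: contrapT => /forallNP bad; apply: near_v.
  apply/nbhs_ballP; exists k.+1%:R^-1 => /=; first by rewrite invr_gt0.
  move=> w vw /=; rewrite distrC normr_normc eE ltcR ltNge; apply/negP => ew.
  by apply: (bad w); split.
have [w wP] := choice bad.
have : normc (fourier f (tuple_of_row (w k)) - fourier f (tuple_of_row v))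
    @[k --> \oo] --> 0.
  apply: fourier_cvg => // i; apply/cvgrPdist_lt => d d0.
  have [k _ kd] := near_infty_natSinv_lt (PosNum d0).
  exists k => // l /= kl; rewrite !tnth_mktuple.
  have [[_ vw] _] := wP l; apply: lt_trans (vw ord0 i) _.
  exact: kd.
move=> /cvgr0Pnorm_lt/(_ _ Re_e)[k _ /(_ k (leqnn k))].
rewrite ger0_norm ?normc_ge0// ltNge.
by have [_ ->] := wP k.
Qed.

Lemma fourier_small_coord n (f : Rn R n -> R[i]) (e : R) (i : 'I_n) :
  L1 f -> 0 < e ->
  exists M : R, forall x, M < `|tnth x i| -> normc (fourier f x) < e.
Proof.
move=> fL e0; apply: contrapT => /forallNP bad.
have {}bad (k : nat) : exists x, k%:R < `|tnth x i| /\ e <= normc (fourier f x).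
  have /existsNP[x /not_implyP[kx]] := bad k%:R.
  by move=> /negP; rewrite -leNgt => ?; exists x.
have [x xP] := choice bad.
have : normc (fourier f (x k)) @[k --> \oo] --> 0.
  apply: (@fourier_cvg0 _ _ _ _ i) => // M.
  exists (Num.truncn `|M|).+1 => // k /= Mk; have [+ _] := xP k; apply: le_lt_trans.
  rewrite (le_trans (ler_norm _))// (le_trans (ltW (truncnS_gt _)))//.
  by rewrite ler_nat.
move=> /cvgr0Pnorm_lt/(_ _ e0)[k _ /(_ k (leqnn k))].
rewrite ger0_norm ?normc_ge0// ltNge.
by have [_ ->] := xP k.
Qed.

(** The compact set is a box: outside it some coordinate i exceeds the threshold
    M i obtained for that coordinate. *)
Lemma C0_fourier n (f : Rn R n -> R[i]) : L1 f -> C0 (fourier f).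
Proof.
move=> fL; split; first exact: continuous_fourier.
move=> e e0.
have [M MP] := choice (fun i => fourier_small_coord i fL e0).
exists [set v : 'rV[R]_n | forall i, `[- `|M i|, `|M i|]%classic (v ord0 i)].
split.
  apply: (@rV_compact _ _ (fun i => `[- `|M i|, `|M i|]%classic)) => i.
  exact: segment_compact.
move=> v nKv; apply: contrapT => ge_e; apply: nKv => i /=.
rewrite in_itv/= -ler_norml leNgt; apply/negP => Mv; apply: ge_e.
apply: (MP i); rewrite tnth_mktuple; apply: le_lt_trans Mv.
exact: ler_norm.
Qed.

End vanishing.

(** * Infinite tensor products *)

Section tensors.
Context {R : realType}.
Import Normc.
Implicit Types (u : R -> R) (x : nat -> R).

Definition tail_prod u n x : R := limn (fun N => \prod_(n <= k < N) u (x k)).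

(** The limit of a divergent sequence is 0 by convention.  If u (x n) is nonzero,
    the products from n and from n + 1 converge or diverge together; if it is 0,
    the products from n are eventually 0.  Hence the factor comes out in every
    case. *)
Lemma tail_prodS u n x : tail_prod u n x = u (x n) * tail_prod u n.+1 x.
Proof.
pose P m N := \prod_(m <= k < N) u (x k).
have PS : \forall N \near \oo, P n N = u (x n) * P n.+1 N.
  by exists n.+1 => // N nN; rewrite /P big_ltn.
rewrite -[LHS]/(limn (P n)) -[tail_prod _ _ _]/(limn (P n.+1)).
have [cP|dP] := pselect (cvgn (P n.+1)).
  apply: cvg_lim => //; apply: cvg_trans (cvgMl_tmp cP).
  by apply: near_eq_cvg; near=> N; symmetry; near: N.
have [un0|un0] := eqVneq (u (x n)) 0.
  rewrite un0 mul0r; apply: cvg_lim => //.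
  by apply: cvg_near_cst; near=> N; rewrite (near PS N)// un0 mul0r.
have -> : limn (P n.+1) = 0 by exact: dvgP.
rewrite mulr0; apply: dvgP.
move=> cP; apply: dP.
apply: cvgP; apply: cvg_trans (cvgMl_tmp (a := (u (x n))^-1) cP).
apply: near_eq_cvg; near=> N; rewrite (near PS N)// mulKf//.
Unshelve. all: by end_near. Qed.

Lemma tail_prod_le1 u n x : (forall y, `|u y| <= 1) -> `|tail_prod u n x| <= 1.
Proof.
move=> u1; rewrite /tail_prod; set P := (fun N => _).
have [cP|dP] := pselect (cvgn P); last by rewrite (dvgP dP) normr0.
apply: (cvgr_to_le (cvg_norm cP)); apply: nearW => N.
rewrite /P normr_prod; apply: prodr_ile1 => k _.
by rewrite normr_ge0 u1.
Qed.

(** As hhat y is an integral of cosines against chi_I, it is at most the integral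
    of chi_I, which is hhat 0 = 1. *)
Lemma normr_hhat_le1 (y : R) : `|hhat y| <= 1.
Proof.
rewrite -[hhat y]mul1r -cos0 -Rintegral_chiI_cos.
apply: le_trans (norm_Rintegral_le_norm integrable_chiI _ _) _ => //.
- by apply: continuous_measurable_fun; exact: continuous_cos_affine.
- by move=> z; exact: cos_max.
have := @Rintegral_chiI_cos R 0 0; rewrite cos0 /hhat eqxx mul1r => <-.
rewrite le_eqVlt; apply/orP; left; apply/eqP; apply: eq_Rintegral => z _.
by rewrite mulr0 mul0r add0r cos0 mulr1 /chiI indicE ger0_norm.
Qed.

Lemma tensorE u n (f : Rn R n -> R[i]) x :
  tensor u f x = f [tuple x i | i < n] * (tail_prod u n x)%:C.
Proof. by []. Qed.

Lemma tensor_snoc u n (f : Rn R n -> R[i]) :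
  tensor u (fun t : Rn R n.+1 => f (initT t) * (u (tnth t ord_max))%:C) =
  tensor u f.
Proof.
apply/funext => x; rewrite !tensorE tnth_mktuple [tail_prod u n x]tail_prodS rmorphM -mulrA.
congr (f _ * _); apply: eq_from_tnth => i.
by rewrite !tnth_mktuple.
Qed.

End tensors.

(** * The transform on the union of all levels *)

Section transform_pairs.
Context {R : realType}.
Import Normc.
Implicit Types F G : (nat -> R) -> R[i].

(** The transform is kept as a relation indexed by the level, so that a function
    of the union can be moved to a higher level without first proving that its
    transform does not depend on the level. *)
Definition transform_pair n F G := exists f : Rn R n -> R[i],
  [/\ L1 f, F = tensor chiI f & G = tensor hhat (fourier f)].

Lemma L1_snoc_chiI n (f : Rn R n -> R[i]) : L1 f ->
  L1 (fun t : Rn R n.+1 => f (initT t) * (chiI (tnth t ord_max))%:C).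
Proof.
move=> [rf jf]; split.
  rewrite (_ : (fun y => _) = EFin \o
    (fun t => complex.Re (f (initT t)) * chiI (tnth t ord_max))).
    exact: integrable_snoc_chiI rf.
  by apply/funext => t /=; rewrite ReM /= mulr0 subr0.
rewrite (_ : (fun y => _) = EFin \o
  (fun t => complex.Im (f (initT t)) * chiI (tnth t ord_max))).
  exact: integrable_snoc_chiI jf.
by apply/funext => t /=; rewrite ImM /= mulr0 add0r.
Qed.

Lemma fourier_snoc_chiI n (f : Rn R n -> R[i]) (x : Rn R n.+1) : L1 f ->
  fourier (fun t : Rn R n.+1 => f (initT t) * (chiI (tnth t ord_max))%:C) x =
  fourier f (initT x) * (hhat (tnth x ord_max))%:C.
Proof.
move=> fL; have [rf jf] := fL.
rewrite (fourier_wave _ (L1_snoc_chiI fL)) (fourier_wave _ fL).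
have -> : (fun t : Rn R n.+1 =>
    complex.Re (f (initT t) * (chiI (tnth t ord_max))%:C)) =
    (fun t => complex.Re (f (initT t)) * chiI (tnth t ord_max)).
  by apply/funext => t; rewrite ReM /= mulr0 subr0.
have -> : (fun t : Rn R n.+1 =>
    complex.Im (f (initT t) * (chiI (tnth t ord_max))%:C)) =
    (fun t => complex.Im (f (initT t)) * chiI (tnth t ord_max)).
  by apply/funext => t; rewrite ImM /= mulr0 add0r.
rewrite !(wave_snoc_chiI _ x rf) !(wave_snoc_chiI _ x jf).
apply/eqP; rewrite eq_complex ReM ImM /= !mulr0 subr0 add0r.
by rewrite -mulrDl -mulrBl !eqxx.
Qed.

(** Moving one level up replaces f by f (x) chi_I, whose transform is
    F(f) (x) hhat; the tensor products over all coordinates do not change. *)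
Lemma transform_pairS n F G : transform_pair n F G -> transform_pair n.+1 F G.
Proof.
move=> [f [fL -> ->]].
exists (fun t => f (initT t) * (chiI (tnth t ord_max))%:C); split.
- exact: L1_snoc_chiI.
- by rewrite tensor_snoc.
- rewrite -(tensor_snoc hhat); congr tensor; apply/funext => x.
  by rewrite fourier_snoc_chiI.
Qed.

Lemma transform_pairW n m F G : (n <= m)%N ->
  transform_pair n F G -> transform_pair m F G.
Proof.
move=> /subnK <-; elim: (m - n)%N => // k IHk /IHk.
by rewrite addSn; exact: transform_pairS.
Qed.

Lemma transform_pair_linear n (a : R[i]) F G F' G' :
  transform_pair n F G -> transform_pair n F' G' ->
  transform_pair n (fun x => a * F x + F' x) (fun x => a * G x + G' x).
Proof.
move=> [f [fL -> ->]] [g [gL -> ->]].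
exists (fun y => a * f y + g y); split; first exact: L1_linear.
  by apply/funext => x; rewrite !tensorE mulrDl mulrA.
by apply/funext => x; rewrite !tensorE fourier_linear// mulrDl mulrA.
Qed.

Lemma normc_tensor_le u n (f : Rn R n -> R[i]) x : (forall y, `|u y| <= 1) ->
  normc (tensor u f x) <= normc (f [tuple x i | i < n]).
Proof.
move=> u1; rewrite tensorE normcM normc_real ler_piMr ?normc_ge0//.
exact: tail_prod_le1.
Qed.

End transform_pairs.

(** * Extension of a bounded linear relation *)

Section bounded_linear_relation.
Context {R : realType}.
Import Normc.

(** Intervals of the line that meet pairwise have a common point: the supremum of
    their left ends. *)
Lemma exists_common_approximation (I : Type) (D : set I) (p d : I -> R) :
  D !=set0 -> (forall i k, D i -> D k -> p i - p k <= d i + d k) ->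
  exists r, forall i, D i -> `|r - p i| <= d i.
Proof.
move=> [i0 Di0] pd; pose A := [set p i - d i | i in D].
have ubA i : D i -> ubound A (p i + d i).
  move=> Di _ [k Dk <-]; have := pd _ _ Dk Di; lra.
have Asup : has_sup A.
  by split; [exists (p i0 - d i0), i0|exists (p i0 + d i0); exact: ubA].
exists (sup A) => i Di; rewrite ler_distl; apply/andP; split.
  by apply: ub_le_sup; [exact: Asup.2|exists i].
by apply: ge_sup; [exact: Asup.1|exact: ubA].
Qed.

Variables (B : normedModType R[i]) (X : Type).
Implicit Types (u v b : B) (G : X -> R[i]) (a : R[i]).

(** The norm of B takes values in R[i]; it is real, and its real part is what
    enters the estimates. *)
Definition rnorm b : R := complex.Re `|b|.

Lemma normr_rnorm b : `|b| = (rnorm b)%:C.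
Proof.
have := normr_ge0 b; rewrite lecE => /andP[/eqP + _]; rewrite /rnorm.
by case: `|b| => r s /= ->.
Qed.

Lemma rnorm0 : rnorm 0 = 0. Proof. by rewrite /rnorm normr0. Qed.

Lemma rnormN b : rnorm (- b) = rnorm b. Proof. by rewrite /rnorm normrN. Qed.

Lemma rnormD b b' : rnorm (b + b') <= rnorm b + rnorm b'.
Proof.
by have := ler_normD b b'; rewrite !normr_rnorm -rmorphD lecR.
Qed.

Lemma rnormZ a b : rnorm (a *: b) = normc a * rnorm b.
Proof. by rewrite /rnorm normrZ normr_normc normr_rnorm -rmorphM. Qed.

Lemma normcD (z z' : R[i]) : normc (z + z') <= normc z + normc z'.
Proof. exact: le_normcD. Qed.

Variables (Gamma : B -> (X -> R[i]) -> Prop) (C : R).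
Hypotheses (C_ge0 : 0 <= C)
  (Gamma_linear : forall a b G b' G', Gamma b G -> Gamma b' G' ->
     Gamma (a *: b + b') (fun x => a * G x + G' x))
  (Gamma_bounded : forall b G x, Gamma b G -> normc (G x) <= C * rnorm b)
  (Gamma_dense : forall u (e : R), 0 < e ->
     exists b G, Gamma b G /\ rnorm (u - b) < e).

(** The real and the imaginary part of the value are chosen separately, each
    within C |u - b| of the given one; hence the factor 2. *)
Lemma exists_extension_value u x : exists c : R[i], forall b G,
  Gamma b G -> normc (c - G x) <= 2 * C * rnorm (u - b).
Proof.
pose D := [set bG : B * (X -> R[i]) | Gamma bG.1 bG.2].
pose d (bG : B * (X -> R[i])) := C * rnorm (u - bG.1).
have D0 : D !=set0.
  by have [b [G [bG _]]] := Gamma_dense u ltr01; exists (b, G).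
have close (i k : B * (X -> R[i])) : D i -> D k ->
    normc (i.2 x - k.2 x) <= d i + d k.
  move=> Di Dk; have := Gamma_bounded x (Gamma_linear (-1) Dk Di).
  rewrite mulN1r addrC => /le_trans; apply.
  rewrite /d -mulrDr ler_wpM2l// scaleN1r addrC.
  rewrite (_ : i.1 - k.1 = - (u - i.1) + (u - k.1)).
    by rewrite (le_trans (rnormD _ _))// rnormN.
  by rewrite opprB addrA subrK.
have [r rP] : exists r, forall i, D i -> `|r - complex.Re (i.2 x)| <= d i.
  apply: exists_common_approximation => // i k Di Dk.
  apply: le_trans (close i k Di Dk); apply: le_trans (normr_Re_le _).
  rewrite ReD; apply: le_trans (ler_norm _).
  by case: (k.2 x).
have [s sP] : exists s, forall i, D i -> `|s - complex.Im (i.2 x)| <= d i.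
  apply: exists_common_approximation => // i k Di Dk.
  apply: le_trans (close i k Di Dk); apply: le_trans (normr_Im_le _).
  rewrite ImD; apply: le_trans (ler_norm _).
  by case: (k.2 x).
exists (r +i* s) => b G bG.
have := rP (b, G) bG; have := sP (b, G) bG => /= sG rG.
rewrite (le_trans (normc_le_ReIm _))//.
rewrite -mulrA mulr_natl mulr2n lerD//.
  by apply: le_trans rG; case: (G x).
by apply: le_trans sG; case: (G x).
Qed.

Lemma eq_of_dist_le (z z' : R[i]) (K : R) : 0 <= K ->
  (forall e : R, 0 < e -> normc (z - z') <= K * e) -> z = z'.
Proof.
move=> K0 small; apply/eqP; rewrite -subr_eq0; apply/eqP/eq0_normc/eqP.
rewrite eq_le normc_ge0 andbT; apply/ler_addgt0Pl => e e0; rewrite addr0.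
have K1 : 0 < K + 1 by rewrite ltr_wpDl.
apply: le_trans (small (e / (K + 1)) _) _; first exact: divr_gt0.
by rewrite mulrCA ler_piMr ?(ltW e0)// ler_pdivrMr// mul1r lerDl.
Qed.

(** The estimates for u and v, transported by linearity of the relation, show
    that T (a u + v) and a T u + T v are at distance at most a multiple of every
    e > 0. *)
Lemma exists_linear_extension :
  exists T : {linear B -> X -> R[i]^o}, forall u b G x,
    Gamma b G -> normc (T u x - G x) <= 2 * C * rnorm (u - b).
Proof.
have [T0 T0P] := choice (fun ux : B * X => exists_extension_value ux.1 ux.2).
pose T u : X -> R[i]^o := fun x => T0 (u, x).
have TP u b G x : Gamma b G -> normc (T u x - G x) <= 2 * C * rnorm (u - b).
  exact: (T0P (u, x)).
have Tlin : linear T.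
  move=> a u v; apply/funext => x.
  (* K e is the sum of the three errors below. *)
  pose K := 4 * C * (normc a + 1).
  apply: (@eq_of_dist_le _ _ K).
    by rewrite !mulr_ge0// addr_ge0// normc_ge0.
  move=> e e0.
  have [b [G [bG ub]]] := Gamma_dense u e0.
  have [b' [G' [bG' vb]]] := Gamma_dense v e0.
  have le1 : rnorm (a *: u + v - (a *: b + b')) <= (normc a + 1) * e.
    rewrite opprD addrACA -scalerBr (le_trans (rnormD _ _))// rnormZ mulrDl mul1r.
    by rewrite lerD// ?(ltW vb)// ler_wpM2l ?normc_ge0// ltW.
  have d1 : normc (T (a *: u + v) x - (a * G x + G' x)) <=
      2 * C * ((normc a + 1) * e).
    apply: le_trans (TP _ _ _ _ (Gamma_linear a bG bG')) _.
    by rewrite ler_wpM2l// mulr_ge0.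
  have d2 : normc (a * (T u x - G x)) <= normc a * (2 * C * e).
    rewrite normcM ler_wpM2l ?normc_ge0//.
    apply: le_trans (TP _ _ _ _ bG) _.
    by rewrite ler_wpM2l ?mulr_ge0// ltW.
  have d3 : normc (T v x - G' x) <= 2 * C * e.
    apply: le_trans (TP _ _ _ _ bG') _.
    by rewrite ler_wpM2l ?mulr_ge0// ltW.
  rewrite (_ : _ - _ = (T (a *: u + v) x - (a * G x + G' x)) -
      (a * (T u x - G x) + (T v x - G' x))).
    rewrite (le_trans (normcD _ _))// normcN.
    rewrite (le_trans (lerD d1 (le_trans (normcD _ _) (lerD d2 d3))))//.
    by rewrite /K le_eqVlt; apply/orP; left; apply/eqP; ring.
  rewrite -[(a *: T u + T v) x]/(a * T u x + T v x).
  by ring.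
pose mT := GRing.isLinear.Build R[i] B (X -> R[i]^o) *:%R T Tlin.
pose LT : {linear B -> X -> R[i]^o} := HB.pack T mT.
by exists LT.
Qed.

End bounded_linear_relation.

(** * The Fourier transform on the completion *)

Theorem theorem5p4 (R : realType) (B : completeNormedModType R[i])
  (j : ((nat -> R) -> R[i]) -> B) (hB : is_L1_completion j) :
  exists T : {linear B -> (nat -> R) -> R[i]^o},
    [/\ (forall (n : nat) (f : Rn R n -> R[i]), (0 < n)%N -> L1 f ->
           T (j (tensor chiI f)) = tensor hhat (fourier f)),
        (forall u : B, C0_closure (T u)) &
        (exists M : R, forall u : B,
           (supnorm (T u) <= (M * complex.Re `|u|)%:E)%E)].
Proof.
pose Gamma (b : B) (G : (nat -> R) -> R[i]) := exists n F,
  [/\ (0 < n)%N, transform_pair n F G & b = j F].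
have pairU n F G : (0 < n)%N -> transform_pair n F G -> L1_union F.
  by move=> n0 [f [fL -> _]]; exists n, f.
have Gamma_linear (a : R[i]) b G b' G' : Gamma b G -> Gamma b' G' ->
    Gamma (a *: b + b') (fun x => a * G x + G' x).
  move=> [n [F [n0 FG ->]]] [m [F' [m0 FG' ->]]].
  exists (maxn n m), (fun x => a * F x + F' x); split.
  - by rewrite leq_max n0.
  - apply: transform_pair_linear.
      exact: transform_pairW (leq_maxl _ _) FG.
    exact: transform_pairW (leq_maxr _ _) FG'.
  - by rewrite (completion_linear hB)//; [exact: pairU FG|exact: pairU FG'].
have Gamma_bounded b G x : Gamma b G -> Normc.normc (G x) <= 4 * rnorm b.
  move=> [n [F [n0 [f [fL -> ->]] ->]]].
  rewrite /rnorm (completion_norm hB)//.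
  apply: le_trans (normc_tensor_le _ _ (@normr_hhat_le1 R)) _.
  exact: normc_fourier_le.
have Gamma_dense u (e : R) : 0 < e -> exists b G, Gamma b G /\ rnorm (u - b) < e.
  move=> e0.
  have ball0 : ball u (e%:C) !=set0.
    by exists u; apply: ballxx; rewrite ltcR.
  have [b [ub [F [n [f [n0 fL FE]]] jF]]] :=
    completion_dense hB ball0 (ball_open _ _).
  exists b, (tensor hhat (fourier f)); split.
    by exists n, F; split => //; exists f.
  by move: ub; rewrite -ball_normE /= normr_rnorm ltcR.
have four_ge0 : (0 : R) <= 4 by [].
have [T TP] := exists_linear_extension four_ge0
  Gamma_linear Gamma_bounded Gamma_dense.
exists T; split.
- move=> n f n0 fL; apply/funext => x.
  have : Gamma (j (tensor chiI f)) (tensor hhat (fourier f)).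
    by exists n, (tensor chiI f); split => //; exists f.
  move=> /(TP (j (tensor chiI f)) _ _ x); rewrite subrr rnorm0 mulr0 => le0.
  apply/eqP; rewrite -subr_eq0; apply/eqP/Normc.eq0_normc/eqP.
  by rewrite eq_le le0 normc_ge0.
- move=> u e e0.
  (* The extension lemma gives 2 * 4 * (e / 16) = e / 2 as a uniform error. *)
  have e16 : 0 < e / 16 by lra.
  have [b [G [bG ub]]] := Gamma_dense u (e / 16) e16.
  have [n [F [n0 [f [fL FE GE]] _]]] := bG.
  exists G; first by exists n, (fourier f); split => //; exact: C0_fourier.
  apply: (@le_lt_trans _ _ (e / 2)%:E); last by rewrite lte_fin; lra.
  apply: ge_ereal_sup => _ [x _ <-]; rewrite lee_fin.
  apply: le_trans (TP _ _ _ x bG) _; lra.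
(* The relation contains (0, 0), so that T u is within 2 * 4 * |u| of 0. *)
- exists 8 => u; apply: ge_ereal_sup => _ [x _ <-]; rewrite lee_fin.
  have [b [G [bG _]]] := Gamma_dense 0 1 ltr01.
  have := TP u _ _ x (Gamma_linear (-1) _ _ _ _ bG bG).
  rewrite scaleN1r addNr subr0 (_ : _ * G x + G x = 0) ?subr0; last by ring.
  by rewrite (_ : 2 * 4 = 8) //; ring.
Qed.
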